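(* Let $G$ be any finite simple graph with non-negative edge weights, and suppose there exists a rank-$r$ optimal solution to the MAXCUT SDP of $G$. Then for any vertex-split graph $\widetilde{G}$ of $G$, there exists a rank-$r$ optimal solution to the MAXCUT SDP of $\widetilde{G}$.
   Context: Given a weighted graph $G=(V,E,\mathbf{w})$ on $n$ vertices and integers $p_i\ge1$, $i\in[n]$, the vertex-split graph $\widetilde{G}$ is obtained by replacing each vertex $i$ with $p_i$ distinct copies; for each edge $ij\in E$ all possible edges are added between the copies of $i$ and the copies of $j$, each with weight $w_{ij}/(p_ip_j)$ (there are no edges among copies of the same vertex). The Laplacian $\mathcal{L}_G$ of a graph $G=(V,E)$ with edge weights $w_{ij}$ ($w_{ij}=0$ for non-edges) is the $V\times V$ matrix with off-diagonal entries $-w_{ij}$ and diagonal entries $\sum_{j\ne i}w_{ij}$. The MAXCUT SDP of $G$ is: maximize $\frac14\langle \mathcal{L}_G,\mathbf{X}\rangle$ over symmetric matrices $\mathbf{X}\in\mathbb{R}^{V\times V}$ with $X_{ii}=1$ for all $i\in V$ and $\mathbf{X}\succeq \mathbf{0}$, where $\langle \mathbf{A},\mathbf{B}\rangle=\operatorname{tr}(\mathbf{A}\mathbf{B})$. *)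

(* Defs.v *)
From HB Require Import structures.
From mathcomp Require Import all_boot all_order all_algebra.
From mathcomp Require Import reals.

Set Implicit Arguments.
Unset Strict Implicit.
Unset Printing Implicit Defensive.

Import Order.TTheory GRing.Theory Num.Theory.

Local Open Scope ring_scope.

(* Finite simple weighted graphs; the weight function is extended by 0 to
   the non-edges. The sign of the weights is not constrained here. *)
Record wgraph (R : realType) (V : finType) := WGraph {
  edge : rel V;
  weight : V -> V -> R;
  edge_sym : symmetric edge;
  edge_irr : irreflexive edge;
  weight_sym : forall i j, weight i j = weight j i;
  weight_nonedge : forall i j, ~~ edge i j -> weight i j = 0
}.

Definition nonneg_weights (R : realType) (V : finType) (G : wgraph R V) : Prop :=
  forall i j : V, edge G i j -> 0 <= weight G i j.

(* V x V matrices are encoded as square matrices of size #|V|, through the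
   enumeration [enum_val : 'I_#|V| -> V] of the vertices. *)
Definition laplacian (R : realType) (V : finType) (G : wgraph R V) :
    'M[R]_#|V| :=
  \matrix_(a, b)
    if a == b then \sum_(j : V | j != enum_val a) weight G (enum_val a) j
    else - weight G (enum_val a) (enum_val b).

Definition psdmx (R : realType) (n : nat) (X : 'M[R]_n) : Prop :=
  X \is symmetricmx /\ forall u : 'cV[R]_n, 0 <= (u^T *m X *m u) 0 0.

Definition maxcut_feasible (R : realType) (V : finType) (X : 'M[R]_#|V|) : Prop :=
  (forall a, X a a = 1) /\ psdmx X.

Definition maxcut_obj (R : realType) (V : finType) (G : wgraph R V)
    (X : 'M[R]_#|V|) : R :=
  4^-1 * \tr (laplacian G *m X).

Definition maxcut_optimal (R : realType) (V : finType) (G : wgraph R V)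
    (X : 'M[R]_#|V|) : Prop :=
  maxcut_feasible X /\
  forall Y : 'M[R]_#|V|, maxcut_feasible Y -> maxcut_obj G Y <= maxcut_obj G X.

Section VertexSplit.
Variables (R : realType) (V : finType) (G : wgraph R V) (p : V -> nat).

(* The copies of the vertex i are the pairs (i, k) with k < p i. *)
Definition split_vertex : finType := {i : V & 'I_(p i)}.

Definition split_edge (x y : split_vertex) : bool := edge G (tag x) (tag y).

Definition split_weight (x y : split_vertex) : R :=
  weight G (tag x) (tag y) / ((p (tag x))%:R * (p (tag y))%:R).

Fact split_edge_sym : symmetric split_edge.
Proof. by move=> x y; apply: edge_sym. Qed.

Fact split_edge_irr : irreflexive split_edge.
Proof. by move=> x; apply: edge_irr. Qed.

Fact split_weight_sym x y : split_weight x y = split_weight y x.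
Proof. by rewrite /split_weight weight_sym [X in _ / X]mulrC. Qed.

Fact split_weight_nonedge x y : ~~ split_edge x y -> split_weight x y = 0.
Proof. by move=> /weight_nonedge; rewrite /split_weight => ->; rewrite mul0r. Qed.

Definition vertex_split : wgraph R split_vertex :=
  WGraph split_edge_sym split_edge_irr split_weight_sym split_weight_nonedge.

End VertexSplit.

(* Main.v *)
Require Import Defs.
From mathcomp Require Import all_boot all_order all_algebra.
From mathcomp Require Import reals.
From mathcomp Require Import lra.

(** On matrices with unit diagonal, the objective of the MAXCUT SDP depends
    only on the adjacency matrix [A]: it is [tr (A (J - X)) / 4], where [J] is
    the all-ones matrix.  Let [S] be the 0/1 matrix that has a row for each copy
    and a column for each vertex and sends a vertex to its copies, and let
    [P = S D^-1] where [D] is the diagonal matrix of the numbers of copies.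
    Counting copies gives [P^T S = 1], and the weights of the split graph are
    chosen exactly so that its adjacency matrix is [P A P^T]; moreover
    [J = S J S^T].

    Hence [X |-> S X S^T], which gives every copy the vector of its vertex,
    maps feasible points of [G] to feasible points of the split graph with the
    same objective value.  It preserves the rank, since
    [X = P^T (S X S^T) P].

    In the other direction, [Y |-> P^T Y P] averages the vectors of the copies
    of each vertex.  It also keeps the value of [tr (A (J - _))] and positivity,
    but the average of unit vectors can be shorter than 1.  Raising the diagonal
    back to 1 adds a nonnegative diagonal matrix, so positivity survives, and
    the value does not move because [A] vanishes on the diagonal.  So the two
    programs have the same optimum, and [S X S^T] is optimal when [X] is. *)

Set Implicit Arguments.
Unset Strict Implicit.
Unset Printing Implicit Defensive.

Import Order.TTheory GRing.Theory Num.Theory.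

Local Open Scope ring_scope.

(** * Positive semidefinite matrices *)

Section PositiveSemidefinite.
Variable R : realType.

Lemma symmetricmxP n (X : 'M[R]_n) : reflect (X = X^T) (X \is symmetricmx).
Proof.
rewrite qualifE /= expr0 scale1r map_mx_id //; exact: eqP.
Qed.

Lemma psdmx_congr m n (B : 'M[R]_(m, n)) (X : 'M[R]_m) :
  psdmx X -> psdmx (B^T *m X *m B).
Proof.
case=> /symmetricmxP symX posX; split.
  by apply/symmetricmxP; rewrite !trmx_mul trmxK -symX mulmxA.
by move=> u; have := posX (B *m u); rewrite trmx_mul !mulmxA.
Qed.

Lemma psdmxD n (X Y : 'M[R]_n) : psdmx X -> psdmx Y -> psdmx (X + Y).
Proof.
case=> /symmetricmxP symX posX [/symmetricmxP symY posY]; split.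
  by apply/symmetricmxP; rewrite linearD /= -symX -symY.
by move=> u; rewrite mulmxDr mulmxDl mxE addr_ge0.
Qed.

Lemma psdmx_diag n (d : 'rV[R]_n) :
  (forall i, 0 <= d 0 i) -> psdmx (diag_mx d).
Proof.
move=> d_ge0; split; first by apply/symmetricmxP; rewrite tr_diag_mx.
move=> u; rewrite mul_mx_diag mxE sumr_ge0 // => i _.
by rewrite !mxE mulrAC mulr_ge0 // -expr2 sqr_ge0.
Qed.

(** Entries are inner products of unit vectors: positivity at [e_a - e_b] says
    that the squared distance [2 - 2 X a b] is nonnegative. *)
Lemma psdmx_le1 n (X : 'M[R]_n) :
  psdmx X -> (forall a, X a a = 1) -> forall a b, X a b <= 1.
Proof.
case=> /symmetricmxP symX posX X1 a b.
have := posX (delta_mx a 0 - delta_mx b 0).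
rewrite [_^T]linearB /= !trmx_delta mulmxBl !mulmxBr !mulmxBl.
rewrite -!rowE -!colE !mxE !X1.
have -> : X b a = X a b by rewrite [in LHS]symX mxE.
lra.
Qed.

End PositiveSemidefinite.

(** * The objective in terms of the adjacency matrix *)

Section Adjacency.
Variables (R : realType) (V : finType) (G : wgraph R V).

Definition adjmx : 'M[R]_#|V| :=
  \matrix_(a, b) weight G (enum_val a) (enum_val b).

Lemma adjmx_diag a : adjmx a a = 0.
Proof. by rewrite mxE weight_nonedge // edge_irr. Qed.

Lemma laplacianE :
  laplacian G = diag_mx (\row_a \sum_b adjmx a b) - adjmx.
Proof.
apply/matrixP => a b; rewrite [in LHS]mxE [in RHS]mxE [(- adjmx) a b]mxE !mxE.
have [<-|_] := eqVneq a b; last by rewrite mulr0n add0r.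
rewrite weight_nonedge ?edge_irr // oppr0 addr0 mulr1n.
under [RHS]eq_bigr do rewrite mxE.
rewrite -(big_enum_val (weight G (enum_val a))) /=.
rewrite [RHS](bigD1 (enum_val a)) //= weight_nonedge ?edge_irr // add0r.
by apply: eq_bigl.
Qed.

(** Unit diagonal turns the degree part of the Laplacian into the constant
    [tr (A J)], which leaves a formula that is linear in [J - X] and does not
    see the diagonal. *)
Lemma maxcut_objE (X : 'M[R]_#|V|) : (forall a, X a a = 1) ->
  maxcut_obj G X = 4^-1 * \tr (adjmx *m (const_mx 1 - X)).
Proof.
move=> X1; rewrite /maxcut_obj laplacianE mulmxBl mulmxBr !linearB /=.
congr (_ * (_ - _)); apply: eq_bigr => a _.
rewrite mul_diag_mx !mxE X1 mulr1.
by apply: eq_bigr => b _; rewrite !mxE mulr1.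
Qed.

Definition unit_diag n (Z : 'M[R]_n) : 'M[R]_n :=
  Z + diag_mx (\row_i (1 - Z i i)).

Lemma unit_diagE n (Z : 'M[R]_n) i : unit_diag Z i i = 1.
Proof. by rewrite !mxE eqxx mulr1n addrC subrK. Qed.

Lemma maxcut_feasible_unit_diag (Z : 'M[R]_#|V|) :
  psdmx Z -> (forall a, Z a a <= 1) -> maxcut_feasible (unit_diag Z).
Proof.
move=> psdZ Z_le1; split=> [a|]; first exact: unit_diagE.
by apply: psdmxD psdZ _; apply: psdmx_diag => a; rewrite mxE subr_ge0.
Qed.

Lemma maxcut_obj_unit_diag (Z : 'M[R]_#|V|) :
  maxcut_obj G (unit_diag Z) = 4^-1 * \tr (adjmx *m (const_mx 1 - Z)).
Proof.
rewrite maxcut_objE; last exact: unit_diagE.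
congr (_ * _); rewrite /unit_diag opprD addrA mulmxBr linearB /=.
rewrite [X in _ - X]big1 ?subr0 // => a _.
by rewrite mul_mx_diag mxE adjmx_diag mul0r.
Qed.

End Adjacency.

(** * Copying and averaging between a graph and its vertex split *)

Section Split.
Variables (R : realType) (V : finType) (p : V -> nat).
Hypothesis p_gt0 : forall i, (0 < p i)%N.

Let N := #|split_vertex p|.

Definition orig (a : 'I_N) : 'I_#|V| := enum_rank (tag (enum_val a)).

Definition copymx : 'M[R]_(N, #|V|) := rowsub orig 1%:M.

Definition invcopies : 'rV[R]_#|V| := \row_i (p (enum_val i))%:R^-1.

Definition avgmx : 'M[R]_(N, #|V|) := copymx *m diag_mx invcopies.

Lemma copymx_conj (X : 'M[R]_#|V|) :
  copymx *m X *m copymx^T = mxsub orig orig X.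
Proof.
rewrite mul_rowsub_mx mul1mx; apply/matrixP => a b.
rewrite !mxE (bigD1 (orig b)) //= big1 => [|i /negPf ne_i].
  by rewrite !mxE eqxx mulr1 addr0.
by rewrite !mxE eq_sym ne_i mulr0.
Qed.

Lemma card_copies (i : 'I_#|V|) :
  \sum_a (orig a == i)%:R = (p (enum_val i))%:R :> R.
Proof.
rewrite -natr_sum; congr _%:R.
transitivity (\sum_(x : split_vertex p) (tag x == enum_val i : nat)).
  rewrite [RHS](big_enum_val (fun x => nat_of_bool (tag x == enum_val i))) /=.
  by apply: eq_bigr => a _; rewrite -(inj_eq enum_val_inj) enum_rankK.
rewrite -big_mkcond /=.
under eq_bigl do rewrite -[_ == _]andbT.
rewrite -(sig_big_dep (fun j => j == enum_val i) (fun _ _ => true)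
  (fun _ _ => 1%N)).
by rewrite big_pred1_eq sum1_card card_ord.
Qed.

(** The rows of [avgmx^T] are the uniform distributions on the copies of a
    vertex, so averaging over copies undoes copying. *)
Lemma avgmx_copymx : avgmx^T *m copymx = 1%:M.
Proof.
rewrite trmx_mul tr_diag_mx -mulmxA mul_diag_mx.
apply/matrixP => i j; rewrite !mxE.
under eq_bigr do rewrite !mxE.
have [<-|ne_ij] := eqVneq i j.
  rewrite (eq_bigr (fun a => (orig a == i)%:R)) => [|a _].
    by rewrite card_copies mulVf // pnatr_eq0 -lt0n p_gt0.
  by case: eqP; rewrite ?mulr1 ?mulr0.
rewrite big1 ?mulr0 // => a _.
by have [->|] := eqVneq (orig a) i; rewrite ?(negPf ne_ij) ?mulr0 ?mul0r.
Qed.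

Lemma avgmx_conj (X : 'M[R]_#|V|) :
  avgmx^T *m (copymx *m X *m copymx^T) *m avgmx = X.
Proof.
have copymx_avgmx : copymx^T *m avgmx = 1%:M.
  by rewrite -[LHS]trmxK trmx_mul trmxK avgmx_copymx trmx1.
rewrite -(mulmxA copymx) (mulmxA avgmx^T) avgmx_copymx mul1mx.
by rewrite -(mulmxA X) copymx_avgmx mulmx1.
Qed.

(** Both [X] and its copied version are products with the other as a factor, so
    neither can have the larger rank. *)
Lemma rank_copymx_conj (X : 'M[R]_#|V|) :
  \rank (copymx *m X *m copymx^T) = \rank X.
Proof.
apply/eqP; rewrite eqn_leq; apply/andP; split.
  exact: leq_trans (mxrankM_maxl _ _) (mxrankM_maxr _ _).
rewrite -{1}[X]avgmx_conj.
exact: leq_trans (mxrankM_maxl _ _) (mxrankM_maxr _ _).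
Qed.

Lemma copymx_const : copymx *m const_mx 1 *m copymx^T = const_mx 1.
Proof. by rewrite copymx_conj; apply/matrixP => a b; rewrite !mxE. Qed.

Lemma avgmx_const : avgmx^T *m const_mx 1 *m avgmx = const_mx 1.
Proof. by rewrite -[X in _ *m X *m _]copymx_const avgmx_conj. Qed.

Lemma avgmx_ge0 a i : 0 <= avgmx a i.
Proof. by rewrite /avgmx mul_mx_diag !mxE mulr_ge0 // invr_ge0 ler0n. Qed.

(** Conjugation by the nonnegative matrix [avgmx] is monotone entrywise and
    fixes the all-ones matrix. *)
Lemma avgmx_conj_le1 (Y : 'M[R]_N) : (forall a b, Y a b <= 1) ->
  forall i j, (avgmx^T *m Y *m avgmx) i j <= 1.
Proof.
move=> Y_le1 i j.
have -> : 1 = (avgmx^T *m const_mx 1 *m avgmx) i j by rewrite avgmx_const mxE.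
rewrite mxE [leRHS]mxE; apply: ler_sum => b _.
apply: ler_wpM2r (avgmx_ge0 _ _) _ _ _.
rewrite mxE [leRHS]mxE; apply: ler_sum => a _.
by apply: ler_wpM2l; rewrite mxE // avgmx_ge0.
Qed.

Lemma maxcut_feasible_copy (X : 'M[R]_#|V|) :
  maxcut_feasible X ->
  maxcut_feasible (copymx *m X *m copymx^T : 'M[R]_#|split_vertex p|).
Proof.
case=> X1 psdX; split=> [a|]; first by rewrite copymx_conj mxE.
by have := psdmx_congr copymx^T psdX; rewrite trmxK.
Qed.

Lemma maxcut_feasible_avg (Y : 'M[R]_#|split_vertex p|) :
  maxcut_feasible Y -> maxcut_feasible (unit_diag (avgmx^T *m Y *m avgmx)).
Proof.
case=> Y1 psdY; apply: maxcut_feasible_unit_diag; first exact: psdmx_congr.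
by move=> a; apply: avgmx_conj_le1; apply: psdmx_le1.
Qed.

Variable G : wgraph R V.

Lemma adjmx_split : adjmx (vertex_split G p) = avgmx *m adjmx G *m avgmx^T.
Proof.
have -> : avgmx *m adjmx G *m avgmx^T =
    copymx *m (diag_mx invcopies *m adjmx G *m diag_mx invcopies) *m copymx^T.
  by rewrite [avgmx^T]trmx_mul tr_diag_mx !mulmxA.
rewrite copymx_conj; apply/matrixP => a b.
rewrite [in RHS]mxE mul_mx_diag mxE mul_diag_mx !mxE !enum_rankK.
by rewrite /= /split_weight invfM mulrA [_^-1 * _]mulrC.
Qed.

(** Cyclicity of the trace moves the averaging from the weights to the
    matrix variable. *)
Lemma maxcut_obj_split (Y : 'M[R]_#|split_vertex p|) : maxcut_feasible Y ->
  maxcut_obj (vertex_split G p) Y =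
  4^-1 * \tr (adjmx G *m (const_mx 1 - avgmx^T *m Y *m avgmx)).
Proof.
case=> Y1 _; rewrite maxcut_objE // adjmx_split; congr (_ * _).
rewrite -(mulmxA avgmx) -(mulmxA avgmx) mxtrace_mulC -(mulmxA _ avgmx^T).
by rewrite -(mulmxA (adjmx G)) mulmxBr mulmxBl avgmx_const.
Qed.

Lemma maxcut_obj_copy (X : 'M[R]_#|V|) : maxcut_feasible X ->
  maxcut_obj (vertex_split G p) (copymx *m X *m copymx^T) = maxcut_obj G X.
Proof.
move=> feasX; rewrite maxcut_obj_split; last exact: maxcut_feasible_copy.
by rewrite avgmx_conj maxcut_objE //; case: feasX.
Qed.

Lemma maxcut_obj_avg (Y : 'M[R]_#|split_vertex p|) : maxcut_feasible Y ->
  maxcut_obj (vertex_split G p) Y =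
  maxcut_obj G (unit_diag (avgmx^T *m Y *m avgmx)).
Proof. by move=> feasY; rewrite maxcut_obj_split // maxcut_obj_unit_diag. Qed.

End Split.

Theorem lemma10 (R : realType) (V : finType) (G : wgraph R V) (r : nat)
    (hw : nonneg_weights G)
    (hopt : exists X : 'M[R]_#|V|, maxcut_optimal G X /\ \rank X = r)
    (p : V -> nat) (hp : forall i : V, (1 <= p i)%N) :
  exists Y : 'M[R]_#|split_vertex p|,
    maxcut_optimal (vertex_split G p) Y /\ \rank Y = r.
Proof.
have [X [[feasX optX] rkX]] := hopt.
exists (copymx R p *m X *m (copymx R p)^T); split; last first.
  by rewrite rank_copymx_conj.
split=> [|Y feasY]; first exact: maxcut_feasible_copy.
rewrite maxcut_obj_copy // maxcut_obj_avg //.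
exact/optX/maxcut_feasible_avg.
Qed.
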